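(* Let $(G,u)$ be an Archimedean norm-complete dimension group with order-unit, and let $S$ be the state space of $(G,u)$. Let $q\colon S\to\mathbb{R}\cup\{+\infty\}$ be a function. Then the following are equivalent: (i) $q\in\Sigma(G,u)$; (ii) $q$ is affine lower semicontinuous and, for every discrete $s\in\partial_{\mathrm{e}}S$, $q(s)\in s[G]\cup\{+\infty\}$.
   Context: A partially ordered abelian group is an abelian group $G$ with a translation-invariant partial order; $G^+=\{x\in G: x\ge0\}$; $\mathbb{N}$ is the set of positive integers. An order-unit is $u\in G^+$ such that for every $x\in G$ there is $n\in\mathbb{N}$ with $x\leq nu$. $G$ is directed if any two elements have a common upper bound; unperforated if for all $m\in\mathbb{N}$ and $x\in G$, $mx\geq0$ implies $x\geq0$; $G$ has interpolation if whenever $a_0,a_1\leq b_0,b_1$ there is $c$ with $a_0,a_1\leq c\leq b_0,b_1$. A dimension group is a directed unperforated partially ordered abelian group with interpolation. $G$ is Archimedean if for all $a,b\in G$, ($na\leq b$ for all integers $n\geq0$) implies $a\leq0$. The canonical norm on $(G,u)$ is $\|x\|_u=\inf\{k/n: k\in\mathbb{Z},\,k\ge0,\ n\in\mathbb{N},\ -ku\leq nx\leq ku\}$; $(G,u)$ is norm-complete if every Cauchy sequence for $\|\cdot\|_u$ converges in $G$. The state space $S$ of $(G,u)$ is the set of all positive (order-preserving) group homomorphisms $s\colon G\to\mathbb{R}$ with $s(u)=1$, a compact convex subset of $\mathbb{R}^G$ (product topology); $\partial_{\mathrm{e}}S$ is its set of extreme points. A state $s$ is discrete if $s[G]=\{s(x):x\in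 G\}$ is a discrete subgroup of $\mathbb{R}$. The natural map $\phi\colon G\to\mathrm{Aff}(S)$ (affine continuous real functions on $S$) is $\phi(x)(s)=s(x)$. An interval of $G$ is a nonempty upward directed lower subset of $G$; $\mathbf{\Lambda}(G)$ is the set of all intervals. $\Sigma(G,u)$ is the set of all functions $S\to\mathbb{R}\cup\{+\infty\}$ of the form $\bigvee\phi[\mathfrak{a}]$ (pointwise supremum of $\{\phi(x):x\in\mathfrak{a}\}$) with $\mathfrak{a}\in\mathbf{\Lambda}(G)$. *)

(* Defs.v *)
From mathcomp Require Import all_boot all_order all_algebra.
From mathcomp Require Import all_classical all_reals all_analysis.

Set Implicit Arguments.
Unset Strict Implicit.
Unset Printing Implicit Defensive.

Import Order.TTheory GRing.Theory Num.Theory.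
Import numFieldNormedType.Exports.

Local Open Scope classical_set_scope.
Local Open Scope ring_scope.

Section partially_ordered_abelian_groups.
Variable G : porderZmodType.

(* [porderZmodType] puts a group law and a partial order on the same carrier
   without relating them, so compatibility has to be required separately. *)
Definition translation_invariant : Prop :=
  forall x y z : G, x <= y -> x + z <= y + z.

Definition upward_directed (A : set G) : Prop :=
  forall x y, A x -> A y -> exists2 z, A z & x <= z /\ y <= z.

Definition lower_set (A : set G) : Prop :=
  forall x y, x <= y -> A y -> A x.

Definition is_interval (A : set G) : Prop :=
  [/\ A !=set0, upward_directed A & lower_set A].

Definition unperforated : Prop :=
  forall (m : nat) (x : G), (0 < m)%N -> 0 <= x *+ m -> 0 <= x.

Definition interpolation : Prop :=
  forall a0 a1 b0 b1 : G,
    a0 <= b0 -> a0 <= b1 -> a1 <= b0 -> a1 <= b1 ->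
    exists c, [/\ a0 <= c, a1 <= c, c <= b0 & c <= b1].

Definition dimension_group : Prop :=
  [/\ translation_invariant, upward_directed [set: G],
      unperforated & interpolation].

Definition archimedean_group : Prop :=
  forall a b : G, (forall n : nat, a *+ n <= b) -> a <= 0.

Definition order_unit (u : G) : Prop :=
  0 <= u /\ forall x : G, exists2 n : nat, (0 < n)%N & x <= u *+ n.

End partially_ordered_abelian_groups.

Section canonical_norm.
Variables (R : realType) (G : porderZmodType) (u : G).

Definition unit_norm (x : G) : R :=
  inf [set r : R | exists k n : nat,
    [/\ (0 < n)%N, - (u *+ k) <= x *+ n, x *+ n <= u *+ k
      & r = k%:R / n%:R]].

Definition norm_cauchy (x : nat -> G) : Prop :=
  forall e : R, 0 < e ->
    exists N : nat, forall m n : nat, (N <= m)%N -> (N <= n)%N ->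
      unit_norm (x m - x n) < e.

Definition norm_complete : Prop :=
  forall x : nat -> G, norm_cauchy x ->
    exists l : G, unit_norm (x n - l) @[n --> \oo] --> (0 : R).

End canonical_norm.

Arguments norm_complete R {G} u.

(* Used as a type, this set carries the topology induced by the topology of
   pointwise convergence, i.e., by the product topology on R^G. *)
Definition state_space (R : realType) (G : porderZmodType) (u : G) :
    set {ptws G -> R} :=
  [set s | [/\ {morph s : x y / x + y}, {homo s : x y / x <= y} & s u = 1]].

Arguments state_space R {G} u.

Section states.
Variables (R : realType) (G : porderZmodType) (u : G).

Definition natural_map (x : G) (s : state_space R u) : R := \val s x.

Definition state_image (s : state_space R u) : set R :=
  [set natural_map x s | x in [set: G]].

Definition discrete_state (s : state_space R u) : Prop :=
  state_image s `<=` isolated (state_image s).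

Definition is_convex_comb (t : R) (s s1 s2 : state_space R u) : Prop :=
  forall x : G, \val s x = t * \val s1 x + (1 - t) * \val s2 x.

Definition extreme_state (s : state_space R u) : Prop :=
  forall (t : R) (s1 s2 : state_space R u), 0 < t < 1 ->
    is_convex_comb t s s1 s2 -> s1 = s /\ s2 = s.

(* At t = 0 and t = 1 this relies on the convention 0 * +oo = 0 of [\bar R]. *)
Definition affine_on_states (q : state_space R u -> \bar R) : Prop :=
  forall (t : R) (s s1 s2 : state_space R u), 0 <= t <= 1 ->
    is_convex_comb t s s1 s2 ->
    q s = (t%:E * q s1 + (1 - t)%:E * q s2)%E.

Definition Sigma : set (state_space R u -> \bar R) :=
  [set q | exists2 a : set G, is_interval a &
    forall s, q s = ereal_sup [set (natural_map x s)%:E | x in a]].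

End states.

(* Main.v *)
Require Import Defs.
From mathcomp Require Import all_boot all_order all_algebra.
From mathcomp Require Import all_classical all_reals all_analysis.
From mathcomp Require Import lra.

(** The supremum of an upward directed set of functions s |-> s x is affine and
    lower semicontinuous, and at a state whose image is discrete a directed set
    of values that is bounded above reaches its supremum. This is the direct
    implication.

    Conversely, given q, the candidate interval is the set of all x such that
    s x <= q s at every state s. It is directed and has supremum q because of
    two facts.

    - [affine_minorant]: q is the supremum of the functions s |-> s y / n below
      it, where y is in the group and n is a positive integer.
    - [exists_dominant]: if the functions s |-> s x_i / n are below q, with
      finitely many x_i, then some z in the group satisfies x_i <= n z for all i
      and s z <= q s for all s. Two functions with n = 1 give directedness; a
      single function s |-> s y / n gives a z in the candidate interval with
      s z >= s y / n.

    To prove [exists_dominant], let Y be the set of all z with x_i <= n z. It is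
    downward directed ([dominates_directed]), so that the infimum h s of the
    values s z, z in Y, is an affine upper semicontinuous function of s. At an
    extreme state s, h s is as small as the group of values of s permits: if
    s x_i <= n (s g) for all i, then h s <= s g ([extreme_state_dominates]).
    Hence h s <= q s, because either s has a dense image or q s, when finite, is
    itself a value of s. A maximum principle for the convex upper semicontinuous
    function h - q then propagates the inequality to all states, and compactness
    yields z in Y with s z <= q s + e for all s ([directed_bauer]).

    To reach e = 0, this is iterated. Once z_j in Y satisfies
    s z_j <= q s + 2^-j, the function s z_j - 2^-j lies below q, so it can be added to the lower
    constraints without destroying the hypothesis: no rounding is involved,
    since the constraints have rational coefficients while the solutions are
    in the group. By directedness z_(j+1) can be chosen below z_j as well. The
    resulting sequence is decreasing and Cauchy, and its limit is the element
    sought.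

    The behaviour of extreme states and [affine_minorant] both rest on a
    Hahn-Banach theorem for abelian groups ([hahn_banach_sublinear]). *)

Import Order.TTheory GRing.Theory Num.Theory.
Import numFieldNormedType.Exports.

Local Open Scope classical_set_scope.
Local Open Scope ring_scope.

(** * Additive maps *)

Section additive_map.
Context {V : zmodType} {R : pzRingType} {f : V -> R}.
Hypothesis fD : {morph f : x y / x + y}.

Lemma additive_map0 : f 0 = 0.
Proof. by apply: (@addrI _ (f 0)); rewrite -fD !addr0. Qed.

Lemma additive_mapN x : f (- x) = - f x.
Proof.
by apply: (@addrI _ (f x)); rewrite -fD !subrr additive_map0.
Qed.

Lemma additive_mapMn x n : f (x *+ n) = n%:R * f x.
Proof.
elim: n => [|n IH]; first by rewrite mulr0n additive_map0 mul0r.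
by rewrite mulrS fD IH mulrS mulrDl mul1r.
Qed.

Lemma additive_mapMz x (m : int) : f (x *~ m) = m%:~R * f x.
Proof.
case: m => n; first exact: additive_mapMn.
by rewrite NegzE !mulrNz additive_mapN additive_mapMn mulNr.
Qed.

End additive_map.

(** * Order and interpolation in the group *)

Section ordered_group.
Context {G : porderZmodType} (htr : translation_invariant G).

Lemma gleD2r (z x y : G) : (x + z <= y + z) = (x <= y).
Proof.
by apply/idP/idP => [/(htr _ _ (- z))|/(htr _ _ z)//]; rewrite !addrK.
Qed.

Lemma gsub_ge0 (x y : G) : (0 <= y - x) = (x <= y).
Proof. by rewrite -[LHS](gleD2r x) add0r subrK. Qed.

Lemma gle_subRL (x y z : G) : (x <= y - z) = (x + z <= y).
Proof. by rewrite -[LHS](gleD2r z) subrK. Qed.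

Lemma gle_subLR (x y z : G) : (x - z <= y) = (x <= y + z).
Proof. by rewrite -[LHS](gleD2r z) subrK. Qed.

Lemma gleD (x y z t : G) : x <= y -> z <= t -> x + z <= y + t.
Proof.
move=> xy zt; apply: (@le_trans _ _ (y + z)); first by rewrite gleD2r.
by rewrite ![y + _]addrC gleD2r.
Qed.

Lemma gleD2l (z x y : G) : (z + x <= z + y) = (x <= y).
Proof. by rewrite ![z + _]addrC gleD2r. Qed.

Lemma gleN2 (x y : G) : (- x <= - y) = (y <= x).
Proof. by rewrite -[LHS]gsub_ge0 opprK addrC gsub_ge0. Qed.

Lemma gleMn (n : nat) (x y : G) : x <= y -> x *+ n <= y *+ n.
Proof. by move=> xy; elim: n => // n IH; rewrite !mulrS; apply: gleD. Qed.

Lemma gMn_ge0 (n : nat) (x : G) : 0 <= x -> 0 <= x *+ n.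
Proof. by move=> /(gleMn n); rewrite mul0rn. Qed.

Lemma gMn_leMn (n m : nat) (x : G) : 0 <= x -> (n <= m)%N -> x *+ n <= x *+ m.
Proof.
move=> x0 nm; rewrite -gsub_ge0 -mulrnBr//; exact: gMn_ge0.
Qed.

Hypothesis hunp : unperforated G.

Lemma gleMn2r (n : nat) (x y : G) :
  (0 < n)%N -> (x *+ n <= y *+ n) = (x <= y).
Proof.
move=> n0; apply/idP/idP => [|/gleMn//].
move=> h; rewrite -gsub_ge0; apply: (hunp _ _ n0).
by rewrite mulrnBl gsub_ge0.
Qed.

Hypothesis hint : interpolation G.

(** Interpolation between {0, v} and {z, z - (k-1) v} yields w such that z - w
    again dominates 0 and (k-1) v. Peeling off k such elements gives w_1 + ...
    + w_k <= z, and any c between {0, v} and {w_1, ..., w_k} is a solution. *)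
Lemma division_interpolation (k : nat) (v z : G) : (0 < k)%N ->
  0 <= z -> v *+ k <= z -> exists w, [/\ 0 <= w, v <= w & w *+ k <= z].
Proof.
case: k => // k _; elim: k z => [|k IH] z z0 kvz; first by exists z.
have z_kv : 0 <= z - v *+ k.+1.
  rewrite gsub_ge0 -(@gleMn2r k.+2)// -mulrnA mulnC mulrnA.
  apply: (le_trans (gleMn k.+1 _ _ kvz)).
  exact: gMn_leMn.
have vz : v <= z.
  rewrite -(@gleMn2r k.+2)//; apply: (le_trans kvz).
  by rewrite -{1}[z]mulr1n; exact: gMn_leMn.
have [|w [w0 vw wz wz']] := hint 0 v z (z - v *+ k.+1) z0 z_kv vz.
  by rewrite gle_subRL -mulrS.
have zw0 : 0 <= z - w by rewrite gsub_ge0.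
have kvzw : v *+ k.+1 <= z - w by rewrite gle_subRL addrC -gle_subRL.
have [w' [w'0 vw' w'z]] := IH _ zw0 kvzw.
have [c [c0 vc cw cw']] := hint _ _ _ _ w0 w'0 vw vw'.
exists c; split=> //; rewrite mulrSr -gle_subRL.
by apply: le_trans (gleMn _ _ _ cw') _; apply: (le_trans w'z); rewrite gleD2l gleN2.
Qed.

Definition dominates (n : nat) (xs : seq G) (y : G) :=
  forall x, x \in xs -> x <= y *+ n.

Lemma seq_interpolation (x0 : G) (xs : seq G) (b0 b1 : G) :
  (forall x, x \in x0 :: xs -> x <= b0 /\ x <= b1) ->
  exists c, [/\ forall x, x \in x0 :: xs -> x <= c, c <= b0 & c <= b1].
Proof.
elim: xs => [|x1 xs IH] hb.
  have [h0 h1] := hb x0 (mem_head _ _).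
  by exists x0; split=> // x; rewrite inE => /eqP ->.
have [c [hc cb0 cb1]] : exists c,
    [/\ forall x, x \in x0 :: xs -> x <= c, c <= b0 & c <= b1].
  by apply: IH => x hx; apply: hb; move: hx; rewrite !inE; case/orP=> ->//; rewrite !orbT.
have [h0 h1] : x1 <= b0 /\ x1 <= b1 by apply: hb; rewrite !inE eqxx orbT.
have [d [cd x1d db0 db1]] := hint _ _ _ _ cb0 cb1 h0 h1.
exists d; split=> // x; rewrite !inE orbCA => /orP[/eqP -> //|hx].
by apply: le_trans cd; apply: hc; rewrite inE.
Qed.

(** Interpolate c between the elements of the list and n y1, n y2, then apply
    division by n below y1: w = y1 - y must satisfy 0 <= w, y1 - y2 <= w and
    n w <= n y1 - c. *)
Lemma dominates_directed (n : nat) (x0 : G) (xs : seq G) (y1 y2 : G) :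
  (0 < n)%N -> dominates n (x0 :: xs) y1 -> dominates n (x0 :: xs) y2 ->
  exists y, [/\ dominates n (x0 :: xs) y, y <= y1 & y <= y2].
Proof.
move=> n0 h1 h2.
have [c [hc cy1 cy2]] : exists c,
    [/\ forall x, x \in x0 :: xs -> x <= c, c <= y1 *+ n & c <= y2 *+ n].
  by apply: seq_interpolation => x hx; split; [exact: h1|exact: h2].
have [||w [w0 vw wz]] := @division_interpolation n (y1 - y2) (y1 *+ n - c) n0.
- by rewrite gsub_ge0.
- by rewrite mulrnBl gleD2l gleN2.
exists (y1 - w); split.
- move=> x /hc xc; apply: (le_trans xc).
  by rewrite mulrnBl gle_subRL addrC -gle_subRL.
- by rewrite gle_subLR -{1}[y1]addr0 gleD2l.
- by rewrite gle_subLR addrC -gle_subLR.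
Qed.

End ordered_group.

(** * A Hahn-Banach theorem for abelian groups *)

Section sublinear.
Context {R : realType} {G : zmodType}.

Definition sublinear (p : G -> R) : Prop :=
  [/\ forall x y, p (x + y) <= p x + p y
    & forall n x, p (x *+ n) = n%:R * p x].

Lemma sublinear_of_ge (p : G -> R) :
  (forall x y, p (x + y) <= p x + p y) -> p 0 = 0 ->
  (forall n x, (0 < n)%N -> n%:R * p x <= p (x *+ n)) -> sublinear p.
Proof.
move=> padd p0 pge; split=> // n x; case: n => [|n].
  by rewrite mulr0n p0 mul0r.
apply/eqP; rewrite eq_le pge// andbT.
elim: n => [|n IH]; first by rewrite mulr1n mul1r.
rewrite mulrSr -[n.+2]addn1 natrD mulrDl mul1r.
by apply: (le_trans (padd _ _)); rewrite lerD2r.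
Qed.

Lemma sublinear0 (p : G -> R) : sublinear p -> p 0 = 0.
Proof. by case=> _ ph; rewrite -[0]/(0 *+ 0) ph mul0r. Qed.

Lemma sublinear_geN (p : G -> R) x : sublinear p -> - p (- x) <= p x.
Proof.
move=> sp; have [padd _] := sp; have := padd x (- x).
rewrite subrr (sublinear0 _ sp); lra.
Qed.

(** The directional derivative of p at infinity in the direction v. It is a
    sublinear functional below p, so it coincides with p when p is minimal. *)
Section directional.
Variables (p : G -> R) (v : G).
Hypothesis sp : sublinear p.

Let values y := [set p (y + v *+ n) - n%:R * p v | n in [set: nat]].
Definition directional (y : G) : R := inf (values y).

Let values_neq0 y : values y !=set0.
Proof. by exists (p (y + v *+ 0) - 0%:R * p v); exists 0. Qed.

Let values_lb y : lbound (values y) (- p (- y)).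
Proof.
move=> _ [n _ <-]; have [padd ph] := sp.
have := padd (y + v *+ n) (- y).
rewrite addrAC subrr add0r ph; lra.
Qed.

Let directional_le y n : directional y <= p (y + v *+ n) - n%:R * p v.
Proof.
by apply: ge_inf; [exists (- p (- y)); exact: values_lb|exists n].
Qed.

Lemma sublinear_directional : sublinear directional.
Proof.
have [padd ph] := sp.
apply: sublinear_of_ge => [x y||n x n0].
- rewrite -lerBlDr; apply: lb_le_inf => // _ [n _ <-].
  rewrite lerBlDr -lerBlDl; apply: lb_le_inf => // _ [m _ <-].
  rewrite lerBlDl; apply: (le_trans (directional_le _ (n + m))).
  rewrite mulrnDr addrACA natrD.
  have := padd (x + v *+ n) (y + v *+ m); lra.
- rewrite /directional (_ : values 0 = [set 0]) ?inf1//.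
  apply/seteqP; split=> [_ [n _ <-]|_ ->] /=.
    by rewrite add0r ph subrr.
  by exists 0 => //; rewrite add0r ph subrr.
- apply: lb_le_inf => // _ [k _ <-].
  (* p (x + k v) - k p v is nonincreasing in k, so k may be replaced by the
     multiple k * n of n *)
  have := directional_le x k; rewrite -(ler_pM2l (_ : 0 < n%:R)) ?ltr0n//.
  move/le_trans; apply; rewrite mulrBr -(ph n (x + _)) mulrnDl -mulrnA.
  have := padd (x *+ n + v *+ k) (v *+ (k * n - k)).
  have kkn : (k <= k * n)%N by rewrite leq_pmulr.
  rewrite -addrA -mulrnDr subnKC// ph natrB// natrM; lra.
Qed.

Lemma directional_le_self y : directional y <= p y.
Proof. by have := directional_le y 0; rewrite mulr0n addr0 mul0r subr0. Qed.

Lemma directionalD y : directional y <= p (y + v) - p v.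
Proof. by have := directional_le y 1; rewrite mulr1n mul1r. Qed.

End directional.

(** Zorn's lemma: the pointwise infimum of a chain is sublinear, and it is
    finite because q x >= - q (- x) >= - p (- x) for all q <= p. *)
Lemma exists_minimal_sublinear (p : G -> R) : sublinear p ->
  exists q, [/\ sublinear q, forall x, q x <= p x &
    forall q', sublinear q' -> (forall x, q' x <= q x) -> q' = q].
Proof.
move=> sp; pose T := {q : G -> R | sublinear q /\ forall x, q x <= p x}.
pose r : rel T := fun a b => `[< forall x, sval b x <= sval a x >].
have val_inj (a b : T) : sval a = sval b -> a = b.
  by case: a b => [a pa] [b pb] /= ab; subst b; congr exist; exact: Prop_irrelevance.
have [|||A Atot|m hm] := @Zorn T r.
- by move=> a; apply/asboolP.
- move=> a b c /asboolP ab /asboolP bc; apply/asboolP => x.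
  exact: le_trans (ab x).
- move=> a b /asboolP ab /asboolP ba; apply: val_inj; apply/funext => x.
  by apply/eqP; rewrite eq_le ba ab.
- have [->|/set0P[a0 Aa0]] := eqVneq A set0.
    by exists (exist _ p (conj sp (fun x => lexx _))) => ? [].
  pose q x := inf [set sval a x | a in A].
  have ne x : [set sval a x | a in A] !=set0 by exists (sval a0 x), a0.
  have qle a x : A a -> q x <= sval a x.
    move=> Aa; apply: ge_inf; last by exists a.
    exists (- p (- x)) => _ [b Ab <-]; have [sb bp] := svalP b.
    by apply: le_trans (sublinear_geN _ x sb); rewrite lerN2.
  have sq : sublinear q.
    apply: sublinear_of_ge => [x y||n x n0].
    + rewrite -lerBlDr; apply: lb_le_inf => // _ [a Aa <-].
      rewrite lerBlDr -lerBlDl; apply: lb_le_inf => // _ [b Ab <-].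
      rewrite lerBlDl.
      have [c [Ac ca cb]] : exists c, [/\ A c, sval c x <= sval a x
          & sval c y <= sval b y].
        by have [/asboolP h|/asboolP h] := Atot _ _ Aa Ab; [exists b|exists a].
      apply: (le_trans (qle _ _ Ac)); have [[cadd _] _] := svalP c.
      by apply: (le_trans (cadd _ _)); rewrite lerD.
    + apply/eqP; rewrite eq_le; apply/andP; split.
        by have [s0 _] := svalP a0; rewrite -(sublinear0 _ s0) qle.
      apply: lb_le_inf => // _ [a Aa <-]; have [sa _] := svalP a.
      by rewrite (sublinear0 _ sa).
    + apply: lb_le_inf => // _ [a Aa <-]; have [[_ ah] _] := svalP a.
      by rewrite ah ler_wpM2l// qle.
  have qp x : q x <= p x.
    by apply: (le_trans (qle _ _ Aa0)); have [_] := svalP a0; apply.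
  exists (exist _ q (conj sq qp)) => a Aa; apply/asboolP => x; exact: qle.
- have [sm mp] := svalP m; exists (sval m); split=> // q' sq' q'm.
  have q'p x : q' x <= p x by exact: le_trans (mp x).
  by have := hm (exist _ q' (conj sq' q'p)) (asboolT q'm); move/(congr1 sval).
Qed.

(** A minimal sublinear functional t equals its derivative in every direction y,
    so t x <= t (x + y) - t y, that is, t is additive. Minimising below the
    derivative of p in the direction v, whose value at - v is at most - p v,
    forces t v = p v. *)
Lemma hahn_banach_sublinear (p : G -> R) (v : G) : sublinear p ->
  exists t : G -> R, [/\ {morph t : x y / x + y}, forall x, t x <= p x & t v = p v].
Proof.
move=> sp.
have [t [st tp tmin]] := exists_minimal_sublinear _ (sublinear_directional p v sp).
have [tadd _] := st.
have tD : {morph t : x y / x + y}.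
  move=> x y; apply/eqP; rewrite eq_le tadd /=.
  have := directionalD t y st x.
  rewrite (tmin _ (sublinear_directional t y st)); last exact: directional_le_self.
  lra.
exists t; split=> // [x|].
  by apply: (le_trans (tp x)); exact: directional_le_self.
apply/eqP; rewrite eq_le (le_trans (tp v)) ?directional_le_self//=.
have := le_trans (tp (- v)) (directionalD p v sp (- v)).
have := tD v (- v); rewrite subrr addNr (sublinear0 _ sp) (sublinear0 _ st).
lra.
Qed.

End sublinear.

(** * Linear inequalities for convex sets of vectors *)

Section convex_alternative.
Context {R : realType}.

Lemma eq0_of_bounded_multiples (d B : R) :
  (forall n : nat, n%:R * `|d| <= B) -> d = 0.
Proof.
move=> h; have [//|d0] := eqVneq d 0.
have dgt0 : 0 < `|d| by rewrite normr_gt0.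
have := h (Num.bound `|B / `|d| |).
rewrite -ler_pdivlMr// leNgt => /negP[].
exact: le_lt_trans (ler_norm _) (archi_boundP (normr_ge0 _)).
Qed.

(** The additive map a |-> f a - a * f 1 vanishes on the integers and f is
    monotone, so this map is bounded; a bounded additive map is zero. *)
Lemma additive_nonneg_linear (f : R -> R) : {morph f : a b / a + b} ->
  (forall a, 0 <= a -> 0 <= f a) -> forall a, f a = a * f 1.
Proof.
move=> fD fge a.
have fZ (m : int) : f m%:~R = m%:~R * f 1 by exact: additive_mapMz.
have fle b c : b <= c -> f b <= f c.
  by rewrite -subr_ge0 => /fge; rewrite fD (additive_mapN fD) subr_ge0.
have f10 : 0 <= f 1 by exact: fge.
pose g b := f b - b * f 1.
have gbound b : `|g b| <= f 1.
  have /andP[h1 h2] := floor_itv b.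
  have := fle _ _ h1; have := fle _ _ (ltW h2); rewrite !fZ intrD.
  have := ler_wpM2r f10 h1; have := ler_wpM2r f10 (ltW h2).
  by rewrite intrD !mulrDl mul1r /g ler_norml => *; apply/andP; split; lra.
apply/eqP; rewrite -subr_eq0; apply/eqP.
apply: (@eq0_of_bounded_multiples _ (f 1)) => n.
have := gbound (a *+ n); rewrite /g (additive_mapMn fD) -(mulr_natl a n).
rewrite -mulrA -mulrBr normrM.
by rewrite normr_nat.
Qed.

(** A finite minimax theorem. The functional p w, the infimum over v in C and
    r >= 0 of the largest coordinate of w + r v, is sublinear, and p w is at
    most the largest coordinate of w. Hahn-Banach gives an additive t <= p.
    The bound by the largest coordinate makes t a weighted average of the
    coordinates, and p (- v) <= 0 gives t v >= 0 on C. The hypothesis that no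
    vector of C is negative in every coordinate keeps p finite. *)
Lemma convex_alternative {I : finType} (C : set {ffun I -> R}) : C !=set0 ->
  (forall (t : R) v w, 0 <= t <= 1 -> C v -> C w ->
     C [ffun i => t * v i + (1 - t) * w i]) ->
  (forall v, C v -> exists i, 0 <= v i) ->
  exists l : I -> R, [/\ forall i, 0 <= l i, \sum_i l i = 1 &
    forall v, C v -> 0 <= \sum_i l i * v i].
Proof.
move=> [v0 Cv0] Cconv Cpos; pose V := {ffun I -> R}.
pose E (w : V) := [set c |
  exists v r, [/\ C v, 0 <= r & forall i, w i + r * v i <= c]].
pose N (w : V) := \sum_i `|w i|.
have leN (w : V) i : `|w i| <= N w.
  by rewrite /N (bigD1 i)//= lerDl sumr_ge0.
have neE w : E w !=set0.
  exists (N w), v0, 0; split=> // i; rewrite mul0r addr0.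
  exact: le_trans (ler_norm _) (leN _ _).
have lbE w : lbound (E w) (- N w).
  move=> c [v [r [Cv r0 h]]]; have [i vi] := Cpos _ Cv.
  apply: le_trans (h i); have := leN w i; rewrite ler_norml => /andP[+ _].
  by have := mulr_ge0 r0 vi; lra.
pose p w := inf (E w).
have ple (w : V) c v r : C v -> 0 <= r -> (forall i, w i + r * v i <= c) -> p w <= c.
  move=> Cv r0 h; apply: ge_inf; first by exists (- N w); exact: lbE.
  by exists v, r.
have ple0 (w : V) c : (forall i, w i <= c) -> p w <= c.
  by move=> h; apply: (ple _ _ v0 0) => // i; rewrite mul0r addr0.
have sp : sublinear p.
  apply: sublinear_of_ge => [w w'||k w k0].
  - rewrite -lerBlDr; apply: lb_le_inf => // c [v [r [Cv r0 h]]].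
    rewrite lerBlDr -lerBlDl; apply: lb_le_inf => // c' [v' [r' [Cv' r'0 h']]].
    rewrite lerBlDl; have [rr'|rr'] := eqVneq (r + r') 0.
      have [r00 r'00] : r = 0 /\ r' = 0 by lra.
      apply: ple0 => i; have := h i; have := h' i.
      by rewrite r00 r'00 !mul0r ffunE; lra.
    have rr'0 : 0 < r + r' by rewrite lt_neqAle eq_sym rr' addr_ge0.
    have t01 : 0 <= r / (r + r') <= 1.
      by rewrite divr_ge0 ?addr_ge0//= ler_pdivrMr// mul1r lerDl.
    apply: (ple _ _ _ (r + r') (Cconv _ _ _ t01 Cv Cv')) => [|i]; first exact: ltW.
    rewrite !ffunE mulrDr mulrA [(r + r') * (r / _)]mulrC divfK//.
    rewrite mulrA mulrBr mulr1 [(r + r') * (r / _)]mulrC divfK//.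
    by have := h i; have := h' i; lra.
  - apply/eqP; rewrite eq_le; apply/andP; split; first by apply: ple0 => i; rewrite ffunE.
    apply: lb_le_inf => // c [v [r [Cv r0 h]]]; have [i vi] := Cpos _ Cv.
    by apply: le_trans (h i); rewrite ffunE add0r mulr_ge0.
  - apply: lb_le_inf => // c [v [r [Cv r0 h]]].
    rewrite mulrC -ler_pdivlMr ?ltr0n//; apply: (ple _ _ v (r / k%:R)) => // [|i].
      by rewrite divr_ge0.
    rewrite ler_pdivlMr ?ltr0n// mulrDl mulrAC divfK ?pnatr_eq0 -?lt0n//.
    by have := h i; rewrite ffunMnE -mulr_natr; lra.
have [t [tD tp _]] := hahn_banach_sublinear p 0 sp.
have tN w := additive_mapN tD w.
have tle (w : V) c : (forall i, w i <= c) -> t w <= c.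
  by move=> h; apply: (le_trans (tp w)); exact: ple0.
pose e i (a : R) : V := [ffun j => if j == i then a else 0].
have te i a : t (e i a) = a * t (e i 1).
  apply: (additive_nonneg_linear (fun a => t (e i a))) => [b c|b b0].
    by rewrite -tD; congr t; apply/ffunP => j; rewrite !ffunE; case: eqP => _; rewrite ?addr0.
  rewrite -oppr_le0 -tN; apply: tle => j; rewrite !ffunE.
  by case: eqP => _; rewrite ?oppr0 ?oppr_le0.
have tsum (w : V) : t w = \sum_i t (e i 1) * w i.
  have {1}-> : w = \sum_i e i (w i).
    apply/ffunP => j; rewrite sum_ffunE (bigD1 j)//= big1 ?addr0 ?ffunE ?eqxx// => i ij.
    by rewrite ffunE eq_sym (negbTE ij).
  rewrite (big_morph t tD (additive_map0 tD)); apply: eq_bigr => i _.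
  by rewrite te mulrC.
exists (fun i => t (e i 1)); split=> [i||v Cv].
- rewrite -oppr_le0 -tN; apply: tle => j; rewrite !ffunE.
  by case: eqP => _; rewrite ?oppr0 ?lerN10.
- have := tsum [ffun=> 1]; under eq_bigr do rewrite ffunE mulr1.
  move=> <-; apply/eqP; rewrite eq_le tle => [|i]; last by rewrite ffunE.
  by rewrite -lerN2 -tN; apply: tle => i; rewrite !ffunE.
- rewrite -tsum -oppr_le0 -tN; apply: (le_trans (tp _)).
  by apply: (ple _ _ v 1) => // i; rewrite !ffunE mul1r addNr.
Qed.

End convex_alternative.

(** * Compactness of the state space *)

Lemma cluster_closed (T : topologicalType) (F : set_system T) (C : set T) p :
  closed C -> F C -> cluster F p -> C p.
Proof.
move=> clC FC; rewrite clusterE => /(_ _ FC).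
by move/closure_id : clC => <-.
Qed.

(** The form in which compactness is used throughout: the members of the family
    are a base of a filter, and a cluster point of it lies in each of them. *)
Lemma compact_directed_bigcap (T : topologicalType) (C : set (set T)) :
  compact [set: T] -> C !=set0 ->
  (forall A, C A -> closed A /\ A !=set0) ->
  (forall A B, C A -> C B -> exists2 D, C D & D `<=` A `&` B) ->
  \bigcap_(A in C) A !=set0.
Proof.
move=> cptT C0 clne dir.
have PF : ProperFilter (filter_from C id).
  apply: filter_from_proper => [|A /clne[]//].
  exact: filter_from_filter.
have [|p [_ clp]] := cptT _ PF; first exact: filterT.
exists p => A CA; have [clA _] := clne _ CA.
by apply: (@cluster_closed _ (filter_from C id)) clp => //; exists A.
Qed.

Lemma compact_set_type (T : topologicalType) (A : set T) :
  compact A -> compact [set: A].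
Proof.
move=> cA F PF _.
have FA : (set_val @ F) A.
  by apply: (@filterS _ F _ setT) (@filterT _ F _) => x _; exact: set_valP.
have [p [Ap clp]] := cA _ _ FA.
exists (exist _ p (mem_set Ap)); split=> // B V FB [W [[U oU <-]] /= Up UV].
have [|_ [[b Bb <-] Ub]] := clp (set_val @` B) U _ (open_nbhs_nbhs (conj oU Up)).
  by apply: (@filterS _ F _ B) FB => b Bb; exists b.
by exists b; split=> //; apply: UV.
Qed.

Section state_space.
Variables (R : realType) (G : porderZmodType) (u : G).
Hypotheses (htr : translation_invariant G) (hunit : order_unit u).
Local Notation S := (state_space R u).
Implicit Types (s : S) (x y : G).

Lemma ptws_eval_continuous x : continuous (fun f : {ptws G -> R} => f x).
Proof. exact: (@proj_continuous G (fun=> R) x). Qed.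

Lemma natural_map_continuous x : continuous (natural_map x : S -> R).
Proof.
move=> s; apply: (@cvg_comp S {ptws G -> R} R set_val (fun f => f x) _ (nbhs (set_val s))).
  exact: initial_continuous.
exact: ptws_eval_continuous.
Qed.

Lemma closed_state_space : closed (state_space R u).
Proof.
have clpre (g : {ptws G -> R} -> R) (D : set R) :
    continuous g -> closed D -> closed (g @^-1` D).
  by move=> cg; apply: preimage_closed => ? ?; exact: cg.
have -> : state_space R u =
    (\bigcap_(xy in [set: G * G])
       (fun f : {ptws G -> R} => f (xy.1 + xy.2) - f xy.1 - f xy.2) @^-1` [set 0]) `&`
    (\bigcap_(xy in [set xy : G * G | xy.1 <= xy.2])
       (fun f : {ptws G -> R} => f xy.2 - f xy.1) @^-1` [set r | 0 <= r]) `&`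
    (fun f : {ptws G -> R} => f u) @^-1` [set 1].
  apply/seteqP; split=> [f [fD fle f1]|f [[fD fle] f1]].
    split; [split|] => // -[x y] /=.
      by move=> _; rewrite fD addrAC addrK subrr.
    by move=> /fle; rewrite subr_ge0.
  split=> // x y; last by move=> xy; rewrite -subr_ge0; exact: (fle (x, y)).
  have /= := fD (x, y) I; rewrite -addrA -opprD => /eqP.
  by rewrite subr_eq0 => /eqP.
do ?apply: closedI.
- apply: closed_bigI => -[x y] _; apply: clpre; last exact: closed_eq.
  move=> f; have ev z := ptws_eval_continuous z f.
  exact: (cvgB (cvgB (ev (x + y)) (ev x)) (ev y)).
- apply: closed_bigI => -[x y] _; apply: clpre; last exact: closed_ge.
  move=> f; have ev z := ptws_eval_continuous z f.
  exact: (cvgB (ev y) (ev x)).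
- by apply: clpre; [exact: ptws_eval_continuous|exact: closed_eq].
Qed.

Lemma stateD x y s : natural_map (x + y) s = natural_map x s + natural_map y s.
Proof. by have [sD _ _] := set_valP s; exact: sD. Qed.

Lemma state_le x y s : x <= y -> natural_map x s <= natural_map y s.
Proof. by have [_ sle _] := set_valP s; exact: sle. Qed.

Lemma state_unit s : natural_map u s = 1.
Proof. by have [_ _ s1] := set_valP s; exact: s1. Qed.

Lemma state0 s : natural_map 0 s = 0.
Proof. exact: (additive_map0 (fun x y => stateD x y s)). Qed.

Lemma stateN x s : natural_map (- x) s = - natural_map x s.
Proof. exact: (additive_mapN (fun x y => stateD x y s)). Qed.

Lemma stateB x y s : natural_map (x - y) s = natural_map x s - natural_map y s.
Proof. by rewrite stateD stateN. Qed.

Lemma stateMn x n s : natural_map (x *+ n) s = n%:R * natural_map x s.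
Proof. exact: (additive_mapMn (fun x y => stateD x y s)). Qed.

Lemma stateMz x (m : int) s : natural_map (x *~ m) s = m%:~R * natural_map x s.
Proof. exact: (additive_mapMz (fun x y => stateD x y s)). Qed.

Lemma state_bounded x : exists n : nat, forall s, `|natural_map x s| <= n%:R.
Proof.
have [_ hu] := hunit; have [[n _ xn] [m _ xm]] := (hu x, hu (- x)).
exists (n + m)%N => s; rewrite natrD ler_norml.
have := state_le _ _ s xn; have := state_le _ _ s xm.
rewrite stateN !stateMn state_unit !mulr1.
have := ler0n R n; have := ler0n R m; lra.
Qed.

(** The order-unit bounds every s x uniformly in s, so the state space is a
    closed subset of a product of compact intervals. *)
Lemma compact_states : compact [set: S].
Proof.
apply: compact_set_type.
have [b hb] := choice state_bounded.
apply: (@subclosed_compact _ _ [set f : {ptws G -> R} |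
  forall x, `[- (b x)%:R, (b x)%:R]%classic (f x)]).
- exact: closed_state_space.
- apply: (@tychonoff G (fun=> R) (fun x => `[- (b x)%:R, (b x)%:R]%classic)) => x.
  exact: segment_compact.
- move=> f hf x /=; rewrite in_itv /= -ler_norml.
  exact: (hb x (exist _ f (mem_set hf))).
Qed.

Section lower_semicontinuous.
Variable q : S -> \bar R.
Hypotheses (qlsc : lower_semicontinuous q) (qNoo : forall s, q s <> -oo%E).

Lemma closed_lsc_le (g : S -> R) : continuous g -> closed [set s | (q s <= (g s)%:E)%E].
Proof.
move=> cg; rewrite -openC openE => s /= /negP; rewrite -ltNge => gq.
have [r gr rq] : exists2 r, g s < r & (r%:E < q s)%E.
  case: (q s) gq => [a| |//]; rewrite ?lte_fin => ga.
    by exists ((g s + a) / 2); rewrite ?lte_fin; lra.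
  by exists (g s + 1); [lra|exact: ltry].
have [V sV Vq] := qlsc _ _ rq.
have : \forall s' \near s, g s' < r by exact: (cvgr_lt _ (cg s)).
move=> h; rewrite /interior; near=> s' => /=; apply/negP; rewrite -ltNge.
apply: (@lt_trans _ _ r%:E); last by apply: Vq; near: s'.
by rewrite lte_fin; near: s'.
Unshelve. all: by end_near. Qed.

(** Otherwise the closed sets where q <= - n, which decrease with n, have a
    common point, at which q is -oo. *)
Lemma lsc_bounded_below : exists B : R, forall s, (B%:E <= q s)%E.
Proof.
have [//|nB] := pselect (exists B : R, forall s, (B%:E <= q s)%E).
pose C := [set [set s | (q s <= (- n%:R)%:E)%E] | n in [set: nat]].
have [||_ [n _ <-]|_ _ [n _ <-] [m _ <-]|s hs] := compact_directed_bigcap S C.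
- exact: compact_states.
- by eexists; exists 0.
- split; first by apply: (closed_lsc_le (fun=> - n%:R)); exact: cst_continuous.
  apply: contrapT => h; apply: nB; exists (- n%:R) => s.
  by rewrite leNgt; apply/negP => /ltW hs; apply: h; exists s.
- exists [set s | (q s <= (- (n + m)%:R)%:E)%E]; first by exists (n + m)%N.
  move=> s /= hs; split; apply: (le_trans hs); rewrite lee_fin natrD;
  have := ler0n R n; have := ler0n R m; lra.
- case E : (q s) => [r| |].
  + have := hs _ (ex_intro2 _ _ (Num.bound `|r|) I erefl); rewrite /= E lee_fin.
    have := archi_boundP (normr_ge0 r).
    by rewrite ltr_norml; lra.
  + by have := hs _ (ex_intro2 _ _ 0%N I erefl); rewrite /= E leye_eq.
  + by have := qNoo s E.
Qed.

End lower_semicontinuous.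

(** * Extreme sets and the maximum principle *)

Definition extreme_set (F : set S) : Prop :=
  forall (t : R) s s1 s2, 0 < t < 1 -> is_convex_comb t s s1 s2 ->
    F s -> F s1 /\ F s2.

Lemma convex_comb_sym (t : R) s s1 s2 :
  is_convex_comb t s s1 s2 -> is_convex_comb (1 - t) s s2 s1.
Proof. by move=> h x; rewrite h subKr addrC. Qed.

Definition downward_directed (Y : set G) : Prop :=
  forall y1 y2, Y y1 -> Y y2 -> exists y, [/\ Y y, y <= y1 & y <= y2].

(** Both weights are positive and q never takes the value -oo, so an infinite
    value at either end of the segment would make q s infinite. *)
Lemma affine_convex_comb (q : S -> \bar R) (t : R) s s1 s2 (c : R) :
  affine_on_states q -> (forall s, q s <> -oo%E) -> 0 < t < 1 ->
  is_convex_comb t s s1 s2 -> (q s <= c%:E)%E ->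
  exists r1 r2, [/\ q s1 = r1%:E, q s2 = r2%:E & t * r1 + (1 - t) * r2 <= c].
Proof.
move=> qaff qNoo /andP[t0 t1] hs.
have t01 : 0 <= t <= 1 by lra.
rewrite (qaff _ _ _ _ t01 hs).
have := qNoo s1; have := qNoo s2.
have h1 : 0 < 1 - t by lra.
case: (q s1) => [r1| |]; case: (q s2) => [r2| |] => // _ _.
- by move=> h; exists r1, r2.
- by rewrite gt0_muley ?lte_fin.
- by rewrite gt0_muley ?lte_fin.
- by rewrite !gt0_muley ?lte_fin.
Qed.

(** M is the maximum over F of f = h - q, where h s is the infimum of s y over
    Y, and F' is the set of maximisers. The infimum h is upper semicontinuous,
    hence the maximum is attained on a compact set; h is affine because Y is
    directed, hence f is convex and F' is extreme. The conditions are spelled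
    out on the members y of Y since f itself may take infinite values. *)
Lemma argmax_extreme_set (F : set S) (Y : set G) (q : S -> \bar R) (c0 : R) :
  closed F -> extreme_set F -> Y !=set0 -> downward_directed Y ->
  affine_on_states q -> lower_semicontinuous q -> (forall s, q s <> -oo%E) ->
  (forall y, Y y -> exists2 s, F s & (q s <= (natural_map y s - c0)%:E)%E) ->
  exists M, let F' := F `&` [set s | forall y, Y y ->
    (q s <= (natural_map y s - M)%:E)%E] in
  [/\ closed F', extreme_set F', F' !=set0 &
  forall c,
  (forall y, Y y -> exists2 s, F s & (q s <= (natural_map y s - c)%:E)%E) ->
  c <= M].
Proof.
move=> clF extF [y0 Yy0] dirY qaff qlsc qNoo hc0.
pose E := [set c | forall y, Y y ->
  exists2 s, F s & (q s <= (natural_map y s - c)%:E)%E].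
have [B hB] := lsc_bounded_below q qlsc qNoo.
have [N hN] := state_bounded y0.
have supE : has_sup E.
  split; first by exists c0.
  exists (N%:R - B) => c /(_ _ Yy0)[s _ qs].
  have := le_trans (hB s) qs; rewrite lee_fin.
  have := hN s; rewrite ler_norml; lra.
have leM c : E c -> c <= sup E by move=> Ec; exact: ub_le_sup supE.2 _ Ec.
pose K y c := F `&` [set s | (q s <= (natural_map y s - c)%:E)%E].
have clK y c : closed (K y c).
  apply: closedI => //; apply: (closed_lsc_le q qlsc (fun s => natural_map y s - c)).
  by move=> s; exact: (cvgB (natural_map_continuous y s) (cvg_cst c)).
exists (sup E) => F'; split; last exact: leM.
- rewrite (_ : F' = F `&` \bigcap_(y in Y) K y (sup E)).
    by apply: closedI => //; apply: closed_bigI => y _; exact: clK.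
  apply/seteqP; split=> s [Fs hs]; split=> // y Yy; first by split=> //; exact: hs.
  by have [] := hs y Yy.
- have half t s s1 s2 : 0 < t < 1 -> is_convex_comb t s s1 s2 -> F' s -> F' s1.
    move=> t01 hs [Fs hF']; split; first by have [] := extF _ _ _ _ t01 hs Fs.
    move=> y1 Yy1; rewrite leNgt; apply/negP => lt1.
    have combq c := affine_convex_comb q t s s1 s2 c qaff qNoo t01 hs.
    have [r1 [r2 [q1 q2 _]]] := combq _ (hF' _ Yy1).
    rewrite q1 lte_fin in lt1.
    (* f s1 falls short of M at y1; as f s = M, convexity would force f s2 to
       exceed M by at least d *)
    pose d := t * (r1 - (natural_map y1 s1 - sup E)) / (1 - t).
    have d0 : 0 < d by apply: divr_gt0; [apply: mulr_gt0|]; lra.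
    have [y2 Yy2 lt2] : exists2 y, Y y & natural_map y s2 - (sup E + d) < r2.
      apply: contrapT => h; have : sup E + d <= sup E; last by lra.
      apply: leM => y Yy; exists s2; first by have [] := extF _ _ _ _ t01 hs Fs.
      by rewrite q2 lee_fin leNgt; apply/negP => hy; apply: h; exists y.
    have [y [Yy yy1 yy2]] := dirY _ _ Yy1 Yy2.
    have [r1' [r2' [q1' q2' ineq]]] := combq _ (hF' _ Yy).
    move: q1' q2' ineq; rewrite q1 q2 => -[<-] [<-].
    have -> : natural_map y s = t * natural_map y s1 + (1 - t) * natural_map y s2.
      exact: hs.
    have e1 := state_le _ _ s1 yy1; have e2 := state_le _ _ s2 yy2.
    have : (1 - t) * d = t * (r1 - (natural_map y1 s1 - sup E)).
      by rewrite /d mulrC divfK//; lra.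
    have : t * natural_map y s1 <= t * natural_map y1 s1 by rewrite ler_wpM2l//; lra.
    have : (1 - t) * natural_map y s2 < (1 - t) * (r2 + (sup E + d)).
      by rewrite ltr_pM2l; lra.
    lra.
  move=> t s s1 s2 t01 hs F's; split; first exact: half t01 hs F's.
  by apply: half (convex_comb_sym _ _ _ _ hs) F's; lra.
- pose C := [set A | exists y e, [/\ Y y, 0 < e & A = K y (sup E - e)]].
  have [||_ [y [e [Yy e0 ->]]]|_ _ [y1 [e1 [Yy1 e10 ->]]] [y2 [e2 [Yy2 e20 ->]]]|s hs]
    := compact_directed_bigcap S C.
  + exact: compact_states.
  + by exists (K y0 (sup E - 1)), y0, 1.
  + split; first exact: clK.
    have [c Ec ec] := sup_adherent e0 supE.
    have [s Fs qs] := Ec _ Yy; exists s; split=> //=; apply: (le_trans qs).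
    by rewrite lee_fin; lra.
  + have [y [Yy yy1 yy2]] := dirY _ _ Yy1 Yy2.
    exists (K y (sup E - Num.min e1 e2)).
      by exists y, (Num.min e1 e2); split=> //; rewrite lt_min e10.
    move=> s [Fs /= qs]; split; split=> //=; apply: (le_trans qs); rewrite lee_fin.
      have : Num.min e1 e2 <= e1 by rewrite ge_min lexx.
      by have := state_le _ _ s yy1; lra.
    have : Num.min e1 e2 <= e2 by rewrite ge_min lexx orbT.
    by have := state_le _ _ s yy2; lra.
  + exists s; split=> [|y Yy].
      by have [] := hs _ (ex_intro _ y0 (ex_intro _ 1 (And3 Yy0 ltr01 erefl))).
    apply/lee_addgt0Pr => e e0.
    have [_ /=] := hs _ (ex_intro _ y (ex_intro _ e (And3 Yy e0 erefl))).
    by rewrite -EFinD (_ : _ - _ = natural_map y s - sup E + e)//; lra.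
Qed.

(** Krein-Milman: in a minimal closed extreme set, the maximum of s |-> s x is
    attained at every point, for each x, so that the set is a singleton. Zorn's
    lemma is applied to the removed parts A of F, which increase when the
    remaining extreme sets decrease. *)
Lemma extreme_set_has_extreme_state (F : set S) :
  closed F -> extreme_set F -> F !=set0 -> exists2 s, F s & extreme_state s.
Proof.
move=> clF extF neF.
pose P (A : set S) := [/\ closed (F `\` A), extreme_set (F `\` A) & F `\` A !=set0].
have [U UP Utot|A [[clA extA [s As]] maxA]] := @Zorn_bigcup S P.
  have [->|/set0P[X0 UX0]] := eqVneq U set0; first by rewrite bigcup_set0 /P setD0.
  have DE : F `\` \bigcup_(X in U) X = \bigcap_(X in U) (F `\` X).
    apply/seteqP; split=> [s [Fs nUs] X UX|s hs]; first by split=> // Xs; apply: nUs; exists X.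
    by split=> [|[X UX Xs]]; [have [] := hs _ UX0|have [] := hs _ UX].
  split; rewrite DE.
  - by apply: closed_bigI => X /UP[].
  - move=> t s s1 s2 t01 hs Fs.
    by split=> X UX; have [_ eX _] := UP _ UX; have [] := eX _ _ _ _ t01 hs (Fs _ UX).
  - have [||_ [X UX <-]|_ _ [X UX <-] [Z UZ <-]|s hs] :=
      compact_directed_bigcap S [set F `\` X | X in U].
    + exact: compact_states.
    + by exists (F `\` X0), X0.
    + by have [] := UP _ UX.
    + have [XZ|ZX] := Utot _ _ UX UZ.
        exists (F `\` Z); first by exists Z.
        by move=> s [Fs Zs]; split=> //; split=> // /XZ.
      exists (F `\` X); first by exists X.
      by move=> s [Fs Xs]; split=> //; split=> // /ZX.
    + by exists s => X UX; apply: hs; exists X.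
have constA s' x : (F `\` A) s' -> natural_map x s' = natural_map x s.
  have [|||||y ->|M [clM extM neM leM]] :=
    argmax_extreme_set (F `\` A) [set x] (fun=> 0%E) (natural_map x s) clA extA.
  - by exists x.
  - by move=> _ _ -> ->; exists x.
  - by move=> *; rewrite !mule0 adde0.
  - by move=> ? a a0; exists setT; [exact: filterT|].
  - by [].
  - by exists s => //; rewrite subrr.
  set F' := (F `\` A) `&` _ in clM extM neM.
  have F'E : F `\` (A `|` ~` F') = F'.
    apply/seteqP; split=> [r [_ nr]|r F'r].
      by apply: contrapT => nF'r; apply: nr; right.
    by have [[Fr Ar] _] := F'r; split=> // -[|].
  have PB : ~ (A `<` (A `|` ~` F')) by move=> /maxA; apply; rewrite /P F'E.
  have sub r : (F `\` A) r -> F' r.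
    move=> [Fr Ar]; apply: contrapT => nF'r; apply: PB; split; first by move=> ?; left.
    by move=> /(_ r (or_intror nF'r)).
  have valM r : (F `\` A) r -> natural_map x r = M.
    move=> Ar; apply/eqP; rewrite eq_le; apply/andP; split.
      by apply: leM => _ ->; exists r => //; rewrite subrr.
    by have [_ /(_ x erefl)] := sub _ Ar; rewrite lee_fin subr_ge0.
  by move=> As'; rewrite !valM.
exists s; first by case: As.
have eqs s' : (F `\` A) s' -> s' = s.
  by move=> As'; apply/val_inj/funext => x; exact: constA.
move=> t s1 s2 t01 hs; have [A1 A2] := extA _ _ _ _ t01 hs As.
by split; exact: eqs.
Qed.

(** Bauer's maximum principle for h - q, with h the infimum over Y: if the
    conclusion fails, then the maximum of h - q is at least c, and it is
    attained at some extreme state. *)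
Lemma directed_bauer (Y : set G) (q : S -> \bar R) (c : R) :
  Y !=set0 -> downward_directed Y ->
  affine_on_states q -> lower_semicontinuous q -> (forall s, q s <> -oo%E) ->
  (forall s, extreme_state s ->
     exists2 y, Y y & ((natural_map y s - c)%:E < q s)%E) ->
  exists2 y, Y y & forall s, ((natural_map y s - c)%:E < q s)%E.
Proof.
move=> neY dirY qaff qlsc qNoo hext; apply: contrapT => hno.
have [||y Yy|M [clM extM neM leM]] :=
  argmax_extreme_set setT Y q c _ _ neY dirY qaff qlsc qNoo.
- exact: closedT.
- by [].
- apply: contrapT => hy; apply: hno; exists y => // s.
  by rewrite ltNge; apply/negP => qs; apply: hy; exists s.
have cM : c <= M.
  apply: leM => y Yy; apply: contrapT => hy; apply: hno; exists y => // s.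
  by rewrite ltNge; apply/negP => qs; apply: hy; exists s.
have [s [_ hs] exs] := extreme_set_has_extreme_state _ clM extM neM.
have [y Yy] := hext _ exs; move/lt_le_trans/(_ (hs _ Yy)).
by rewrite lte_fin; lra.
Qed.

(** * Extreme states are lattice-like *)

Lemma additive_unit_eq0 (f : G -> R) :
  {morph f : x y / x + y} -> (forall x, 0 <= x -> 0 <= f x) -> f u = 0 ->
  forall x, f x = 0.
Proof.
move=> fD fge fu x; have [_ hu] := hunit.
have fB a b : f (a - b) = f a - f b by rewrite fD (additive_mapN fD).
have fun0 n : f (u *+ n) = 0 by rewrite (additive_mapMn fD) fu mulr0.
have le0 a : f a <= 0.
  have [n _] := hu a; rewrite -(gsub_ge0 htr) => /fge.
  by rewrite fB fun0 sub0r oppr_ge0.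
apply/eqP; rewrite eq_le le0 /=.
by have := le0 (- x); rewrite (additive_mapN fD) oppr_le0.
Qed.

Lemma state_of_functional (f : G -> R) :
  {morph f : x y / x + y} -> (forall x, 0 <= x -> 0 <= f x) -> 0 < f u ->
  exists s, forall x, natural_map x s = f x / f u.
Proof.
move=> fD fge fu.
have fst : state_space R u (fun x => f x / f u).
  split=> [x y|x y|]; first by rewrite fD mulrDl.
    rewrite -(gsub_ge0 htr) => /fge fxy; rewrite ler_pM2r ?invr_gt0// -subr_ge0.
    by rewrite -[y](subrK x) fD addrK.
  by rewrite divff// gt_eqF.
by exists (exist (fun g => g \in state_space R u) _ (mem_set fst)).
Qed.

(** If 0 < f u < 1, then s is the convex combination, with weights f u and
    1 - f u, of the states obtained by normalising f and s - f. The cases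
    f u = 0 and f u = 1 mean f = 0 and f = s. *)
Lemma extreme_state_dominated s (f : G -> R) : extreme_state s ->
  {morph f : x y / x + y} ->
  (forall x, 0 <= x -> 0 <= f x <= natural_map x s) ->
  forall x, f x = f u * natural_map x s.
Proof.
move=> exs fD fs x; have [u0 _] := hunit.
have fge y : 0 <= y -> 0 <= f y by move/fs/andP=> [].
pose g y := natural_map y s - f y.
have gD : {morph g : y z / y + z} by move=> y z; rewrite /g stateD fD; lra.
have gge y : 0 <= y -> 0 <= g y by move/fs/andP=> [_]; rewrite subr_ge0.
have := fs _ u0; rewrite state_unit => /andP[fu0 fu1].
have gu : g u = 1 - f u by rewrite /g state_unit.
have [fu|fun0] := eqVneq (f u) 0.
  by rewrite fu mul0r; exact: additive_unit_eq0.
have [fu|fun1] := eqVneq (f u) 1.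
  rewrite fu mul1r; have : g x = 0.
    by apply: additive_unit_eq0 => //; rewrite gu fu subrr.
  rewrite /g; lra.
have fu_gt0 : 0 < f u by rewrite lt_neqAle eq_sym fun0.
have gu_gt0 : 0 < g u by rewrite gu subr_gt0 lt_neqAle fun1.
have [s1 hs1] := state_of_functional f fD fge fu_gt0.
have [s2 hs2] := state_of_functional g gD gge gu_gt0.
have t01 : 0 < f u < 1 by rewrite fu_gt0 -subr_gt0 -gu.
have hs : is_convex_comb (f u) s s1 s2.
  move=> y; rewrite -[\val s1 y]/(natural_map y s1) -[\val s2 y]/(natural_map y s2).
  rewrite hs1 hs2 -gu (mulrC (f u)) (mulrC (g u)) !divfK ?gt_eqF//.
  by rewrite /g addrC subrK.
have [<- _] := exs _ _ _ t01 hs.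
by rewrite hs1 mulrC divfK// gt_eqF.
Qed.

Hypotheses (hunp : unperforated G) (hint : interpolation G).

(** The functional p x, the infimum of s z over all z >= 0, x, is sublinear;
    its homogeneity is division by integers in the group. A Hahn-Banach
    functional t <= p with t v = p v satisfies 0 <= t <= s on the positive cone,
    hence is a multiple of s, and p v = t v is nonpositive along with s v. *)
Lemma extreme_state_positive_part s (v : G) (e : R) : extreme_state s ->
  natural_map v s <= 0 -> 0 < e ->
  exists z, [/\ 0 <= z, v <= z & natural_map z s < e].
Proof.
move=> exs sv e0; have [u0 hu] := hunit.
pose E x := [set natural_map z s | z in [set z | 0 <= z /\ x <= z]].
have neE x : E x !=set0.
  have [n _ xn] := hu x; exists (natural_map (u *+ n) s), (u *+ n) => //=.
  by split=> //; exact: gMn_ge0.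
have lbE x : lbound (E x) 0.
  by move=> _ [z [z0 _] <-]; rewrite -(state0 s); exact: state_le.
pose p x := inf (E x).
have ple x z : 0 <= z -> x <= z -> p x <= natural_map z s.
  by move=> z0 xz; apply: ge_inf; [exists 0; exact: lbE|exists z].
have sp : sublinear p.
  apply: sublinear_of_ge => [x y||k x k0].
  - rewrite -lerBlDr; apply: lb_le_inf => // _ [z [z0 xz] <-].
    rewrite lerBlDr -lerBlDl; apply: lb_le_inf => // _ [w [w0 yw] <-].
    rewrite lerBlDl -stateD; apply: ple; last exact: gleD.
    by rewrite -[0]addr0; exact: gleD.
  - apply/eqP; rewrite eq_le lb_le_inf// andbT.
    by rewrite -[leRHS](state0 s); exact: ple.
  - apply: lb_le_inf => // _ [z [z0 xz] <-].
    have [w [w0 xw wz]] := division_interpolation htr hunp hint _ _ _ k0 z0 xz.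
    apply: le_trans (state_le _ _ s wz); rewrite stateMn ler_wpM2l//.
    exact: ple.
have [t [tD tp tv]] := hahn_banach_sublinear p v sp.
have t0 := additive_map0 tD.
have ts x : 0 <= x -> 0 <= t x <= natural_map x s.
  move=> x0; apply/andP; split; last by apply: (le_trans (tp x)); exact: ple.
  have := tD x (- x); rewrite subrr t0.
  have : t (- x) <= 0.
    apply: (le_trans (tp _)); rewrite -[leRHS](state0 s); apply: ple => //.
    by rewrite -[0]oppr0 (gleN2 htr).
  lra.
have := extreme_state_dominated s t exs tD ts v; rewrite tv => pv.
have [||_ [z [z0 vz] <-] ze] := @inf_lt _ (E v) e; last by exists z.
- exact: neE.
- apply: le_lt_trans e0; rewrite -/(p v) pv.
  by rewrite mulr_ge0_le0//; case/andP: (ts _ u0).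
Qed.

(** An accumulation point of the image, which is a group, yields arbitrarily
    small positive values, whose multiples come close to any real number. *)
Lemma nondiscrete_state_dense s (r e : R) : ~ discrete_state s -> 0 < e ->
  exists g, r <= natural_map g s < r + e.
Proof.
move=> nd e0.
have [a [x0 [xa nisoa]]] : exists a x0, natural_map x0 s = a /\
    ~ isolated (state_image s) a.
  by move/existsNP: nd => [a /not_implyP[[x0 _ xa] na]]; exists a, x0.
have [w w0 we] : exists2 w, 0 < natural_map w s & natural_map w s < e.
  apply: contrapT => hw; apply: nisoa; split; first by apply/mem_set; exists x0.
  exists (ball a e); first exact: nbhsx_ballx.
  apply/seteqP; split=> [b [ab [x1 _ x1b]]|_ -> /=]; last first.
    by split; [exact: ballxx|exists x0].
  rewrite -{b}x1b in ab *.
  move: ab; rewrite /ball /= -xa -stateB ltr_norml stateB => /andP[h1 h2].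
  apply/eqP; rewrite eq_le !leNgt; apply/andP; split; apply/negP => h; apply: hw.
    by exists (x1 - x0); rewrite stateB; lra.
  by exists (x0 - x1); rewrite stateB; lra.
exists (w *~ (Num.floor (r / natural_map w s) + 1)).
have /andP[h1 h2] := floor_itv (r / natural_map w s).
rewrite stateMz; move: h1 h2; rewrite ler_pdivlMr// ltr_pdivrMr// intrD.
by rewrite mulrDl mul1r => h1 h2; apply/andP; split; lra.
Qed.

(** Each x - n g has nonpositive value at s, so it lies below some z >= 0 with
    arbitrarily small value; then g + z works, since n z >= z. *)
Lemma extreme_state_dominates s (n : nat) (xs : seq G) (g : G) (e : R) :
  extreme_state s -> (0 < n)%N ->
  (forall x, x \in xs -> natural_map x s <= n%:R * natural_map g s) ->
  0 < e -> exists2 y, dominates n xs y & natural_map y s < natural_map g s + e.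
Proof.
move=> exs n0 hxs e0.
suff [z [z0 hz ze]] : exists z, [/\ 0 <= z,
    forall x, x \in xs -> x - g *+ n <= z & natural_map z s < e].
  exists (g + z); last by rewrite stateD; lra.
  move=> x /hz; rewrite (gle_subLR htr) => /le_trans; apply.
  rewrite mulrnDl addrC (gleD2l htr) -[leLHS]mulr1n.
  exact: gMn_leMn.
elim: xs e e0 hxs => [|x xs IH] e e0 hxs.
  by exists 0; split=> //; rewrite state0.
have e20 : 0 < e / 2 by lra.
have [|z1 [z10 hz1 ze1]] := IH _ e20.
  by move=> x' hx'; apply: hxs; rewrite inE hx' orbT.
have [||z2 [z20 xz2 ze2]] := extreme_state_positive_part s (x - g *+ n) (e / 2) exs.
- by rewrite stateB stateMn subr_le0; apply: hxs; exact: mem_head.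
- exact: e20.
exists (z1 + z2); split; last by rewrite stateD; lra.
  by rewrite -[0]addr0; exact: gleD.
move=> x'; rewrite inE => /orP[/eqP ->|/hz1 h].
  by rewrite -[leLHS]add0r; exact: gleD.
by rewrite -[leLHS]addr0; exact: gleD.
Qed.

(** * Norm limits *)

Lemma unit_norm_le (k n : nat) x : (0 < n)%N ->
  - (u *+ k) <= x *+ n -> x *+ n <= u *+ k -> unit_norm R u x <= k%:R / n%:R.
Proof.
move=> n0 h1 h2; apply: ge_inf; last by exists k, n.
by exists 0 => _ [k' [n' [_ _ _ ->]]]; rewrite divr_ge0.
Qed.

Lemma unit_norm_lt (e : R) x : unit_norm R u x < e ->
  exists k n : nat, [/\ (0 < n)%N, - (u *+ k) <= x *+ n, x *+ n <= u *+ k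
    & k%:R / n%:R < e].
Proof.
move=> /inf_lt[|_ [k [n [n0 h1 h2 ->]]] ke]; last by exists k, n.
have [_ hu] := hunit; have [u0 _] := hunit.
have [k k0 xk] := hu x; have [m m0 xm] := hu (- x).
exists ((k + m)%:R / 1%:R), (k + m)%N, 1%N; split=> //.
  rewrite mulr1n -[leRHS]opprK (gleN2 htr); apply: (le_trans xm).
  by apply: gMn_leMn => //; rewrite leq_addl.
by rewrite mulr1n; apply: (le_trans xk); apply: gMn_leMn => //; rewrite leq_addr.
Qed.

Section completion.
Hypotheses (harch : archimedean_group G) (hcomplete : norm_complete R u).

(** The increments satisfy 0 <= y_j - y_(j+1) <= 2^-j u, so the sequence is
    Cauchy: the j-th tail has size at most 2 * 2^-j. *)
Lemma halving_sequence_converges (y : nat -> G) :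
  (forall j, y j.+1 <= y j) ->
  (forall j, y j *+ 2 ^ j - u <= y j.+1 *+ 2 ^ j) ->
  exists l, forall (e : R) (j0 : nat), 0 < e ->
    exists j, (j0 <= j)%N /\ unit_norm R u (y j - l) < e.
Proof.
move=> ydec yhalf; have [u0 _] := hunit.
have decr j k : y (j + k)%N <= y j.
  by elim: k => [|k IH]; rewrite ?addn0// addnS (le_trans (ydec _)).
(* the geometric sum 2^-j + ... + 2^-(j+k-1), multiplied by 2^(j+k) *)
have tail j k : (y j - y (j + k)%N) *+ 2 ^ (j + k) + u *+ 2 <= u *+ 2 ^ k.+1.
  elim: k => [|k IH]; first by rewrite addn0 subrr mul0rn add0r.
  have h : (y (j + k)%N - y (j + k).+1) *+ 2 ^ (j + k) <= u.
    by rewrite mulrnBl (gle_subLR htr) addrC -(gle_subLR htr).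
  rewrite addnS -[y j](subrK (y (j + k)%N)) -addrA.
  set c := y (j + k)%N - _ in h *; set d := y j - _ in IH *.
  rewrite mulrnDl 2!expnSr !mulrnA -addrA.
  apply: le_trans (gleMn htr 2 _ _ IH); rewrite [leRHS]mulrnDl (gleD2l htr).
  by rewrite [leRHS]mulr2n (gleD2r htr); exact: gleMn.
have tail2 j k : (y j - y (j + k)%N) *+ 2 ^ j <= u *+ 2.
  rewrite -(@gleMn2r _ htr hunp (2 ^ k)) ?expn_gt0// -!mulrnA -expnD -expnS.
  by apply: le_trans (tail j k); rewrite -[leLHS]addr0 (gleD2l htr) gMn_ge0.
have ycauchy : norm_cauchy R u y.
  move=> e e0; pose N := Num.bound (2 / e); exists N => m n Nm Nn.
  have : 2 / e < 2 ^+ N by exact: upper_nthrootP.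
  rewrite ltr_pdivrMr// => hN.
  apply: (@le_lt_trans _ _ (2%:R / (2 ^ N)%:R)); last first.
    by rewrite ltr_pdivrMr ?ltr0n ?expn_gt0// natrX mulrC.
  have hm := tail2 N (m - N)%N; rewrite subnKC// in hm.
  have hn := tail2 N (n - N)%N; rewrite subnKC// in hn.
  have dm := decr N (m - N)%N; rewrite subnKC// in dm.
  have dn := decr N (n - N)%N; rewrite subnKC// in dn.
  apply: unit_norm_le; rewrite ?expn_gt0//.
    rewrite -[leRHS]opprK (gleN2 htr) -mulNrn opprB.
    apply: le_trans hm; apply: gleMn => //.
    by rewrite (gleD2r htr).
  apply: le_trans hn; apply: gleMn => //.
  by rewrite (gleD2r htr).
have [l hl] := hcomplete _ ycauchy.
exists l => e j0 e0.
have [N _ hN] := (cvgrPdist_lt _ _).1 hl e e0.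
exists (maxn N j0); split; first exact: leq_maxr.
have := hN (maxn N j0) (leq_maxl _ _); rewrite /= sub0r normrN.
exact: le_lt_trans (ler_norm _).
Qed.

(** Order-closedness of the group for the norm: the hypothesis says that a - b
    is at most u / m for every m. *)
Lemma archimedean_le (a b : G) :
  (forall m : nat, (0 < m)%N ->
     exists p : nat, (0 < p)%N /\ (a - b) *+ (m * p) <= u *+ p) ->
  a <= b.
Proof.
move=> h; have [u0 _] := hunit; rewrite -[a](subrK b) -[leRHS]add0r (gleD2r htr).
apply: (harch _ u) => -[|m]; first by rewrite mulr0n.
have [p [p0 hp]] := h m.+1 isT.
by rewrite -(@gleMn2r _ htr hunp p)// -mulrnA.
Qed.

(** * Group elements between finitely many constraints and q *)

Variable q : S -> \bar R.
Hypotheses (qaff : affine_on_states q) (qlsc : lower_semicontinuous q).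
Hypothesis qNoo : forall s, q s <> -oo%E.
Hypothesis qdisc : forall s, extreme_state s -> discrete_state s ->
  ([set r%:E | r in state_image s] `|` [set +oo%E]) (q s).

(** At an extreme state with q s finite, q s is approximated from above by a
    value s g, exactly so when s is discrete; hence some solution of the
    constraints has a value at s close to q s, and the maximum principle
    applies to the solutions below y0. *)
Lemma approximate_dominant (n : nat) (x0 : G) (xs : seq G) (y0 : G) (e : R) :
  (0 < n)%N ->
  (forall x, x \in x0 :: xs -> forall s, ((natural_map x s / n%:R)%:E <= q s)%E) ->
  dominates n (x0 :: xs) y0 -> 0 < e ->
  exists y, [/\ dominates n (x0 :: xs) y, y <= y0 &
    forall s, ((natural_map y s - e)%:E < q s)%E].
Proof.
move=> n0 hq hy0 e0.
pose Y := [set y | dominates n (x0 :: xs) y /\ y <= y0].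
have [|||y [hy yy0] qy] := directed_bauer Y q e _ _ qaff qlsc qNoo; last by exists y.
- by exists y0.
- move=> y1 y2 [h1 l1] [h2 l2].
  have [y [hy yy1 yy2]] := dominates_directed htr hunp hint _ _ _ _ _ n0 h1 h2.
  by exists y; split=> //; split=> //; exact: le_trans l1.
move=> s exs; case E : (q s) => [r| |]; last by have := qNoo s E.
  have e20 : 0 < e / 2 by lra.
  have [g /andP[rg gr]] : exists g, r <= natural_map g s < r + e / 2.
    have [ds|nds] := pselect (discrete_state s); last exact: nondiscrete_state_dense.
    have := qdisc s exs ds; rewrite E => -[[_ [g _ <-] [<-]]|//].
    by exists g; lra.
  have [|y1 hy1 sy1] := extreme_state_dominates s n (x0 :: xs) g _ exs n0 _ e20.
    move=> x /hq/(_ s); rewrite E lee_fin ler_pdivrMr ?ltr0n// => /le_trans; apply.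
    by rewrite mulrC ler_wpM2l.
  have [y [hy yy1 yy0]] := dominates_directed htr hunp hint _ _ _ _ _ n0 hy1 hy0.
  exists y => //; rewrite lte_fin; have := state_le _ _ s yy1; lra.
by exists y0; [split|rewrite ltry].
Qed.

(** Successive approximations y_j that satisfy the constraints and lie below
    q + 2^-j. The step from j to j + 1 solves, with denominator n * 2^j, the
    original constraints together with y >= y_j - 2^-j u, and stays below
    y_j. *)
Lemma exists_dominant (n : nat) (x0 : G) (xs : seq G) : (0 < n)%N ->
  (forall x, x \in x0 :: xs -> forall s, ((natural_map x s / n%:R)%:E <= q s)%E) ->
  exists2 y, dominates n (x0 :: xs) y & forall s, ((natural_map y s)%:E <= q s)%E.
Proof.
move=> n0 hq; have [u0 hu] := hunit.
pose X := x0 :: xs.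
pose P (j : nat) y := dominates n X y /\
  forall s, ((natural_map y s - (2 ^+ j)^-1)%:E <= q s)%E.
have [y0 Py0] : exists y, P 0%N y.
  have [y hy] : exists y, dominates n X y.
    have [k hk] : exists k : nat, forall x, x \in X -> x <= u *+ k.
      elim: {P}X => [|x X [k hk]]; first by exists 0%N.
      have [m _ xm] := hu x; exists (m + k)%N => x'.
      rewrite inE => /orP[/eqP ->|/hk h].
        by apply: (le_trans xm); apply: gMn_leMn => //; rewrite leq_addr.
      by apply: (le_trans h); apply: gMn_leMn => //; rewrite leq_addl.
    exists (u *+ k) => x /hk h; apply: (le_trans h).
    by rewrite -mulrnA; apply: gMn_leMn => //; rewrite leq_pmulr.
  have [y' [hy' _ qy']] :=
    approximate_dominant n x0 xs y 1 n0 hq hy ltr01.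
  by exists y'; split=> // s; rewrite expr0 invr1; exact: ltW.
have step (jy : nat * G) : exists y', P jy.1 jy.2 ->
    [/\ P jy.1.+1 y', y' <= jy.2 & jy.2 *+ 2 ^ jy.1 - u <= y' *+ 2 ^ jy.1].
  case: jy => j y /=; have [[hy qy]|nP] := pselect (P j y); last by exists 0.
  have e0 : 0 < (2 ^+ j.+1)^-1 :> R by rewrite invr_gt0 exprn_gt0.
  have N0 : (0 < n * 2 ^ j)%N by rewrite muln_gt0 n0 expn_gt0.
  have pj0 : (0 : R) < 2 ^+ j by rewrite exprn_gt0.
  have nR0 : (0 : R) < n%:R by rewrite ltr0n.
  have [||y' [hy' y'y qy']] := approximate_dominant (n * 2 ^ j)
    ((y *+ 2 ^ j - u) *+ n) [seq x *+ 2 ^ j | x <- X] y _ N0 _ _ e0.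
  - move=> x; rewrite inE => /orP[/eqP ->|/mapP[x' hx' ->]] s.
      rewrite stateMn stateB stateMn state_unit natrM natrX invfM mulrACA.
      rewrite divff ?gt_eqF// mul1r mulrBl mul1r mulrAC divff ?gt_eqF// mul1r.
      exact: qy.
    rewrite stateMn natrM natrX [_ * natural_map _ _]mulrC invfM mulrACA.
    by rewrite divff ?gt_eqF// mulr1; exact: hq.
  - move=> x; rewrite inE => /orP[/eqP ->|/mapP[x' hx' ->]].
      rewrite mulnC mulrnA; apply: gleMn => //.
      by rewrite (gle_subLR htr) -[leLHS]addr0 (gleD2l htr).
    by rewrite mulrnA; apply: gleMn => //; exact: hy.
  exists y' => _; split=> //; first split.
  - move=> x hx; rewrite -(@gleMn2r _ htr hunp (2 ^ j)) ?expn_gt0// -mulrnA.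
    by apply: hy'; rewrite inE; apply/orP; right; apply/mapP; exists x.
  - by move=> s; exact: ltW.
  - rewrite -(@gleMn2r _ htr hunp n)// -[leRHS]mulrnA mulnC.
    by apply: hy'; exact: mem_head.
have [F hF] := choice step.
pose Y := fix Y j := if j is i.+1 then F (i, Y i) else y0.
have PY j : P j (Y j) by elim: j => [//|j IH]; have [] := hF (j, Y j) IH.
have [l hl] := halving_sequence_converges Y
  (fun j => let: And3 _ h _ := hF (j, Y j) (PY j) in h)
  (fun j => let: And3 _ _ h := hF (j, Y j) (PY j) in h).
exists l => [x hx|s].
  apply: archimedean_le => m m0.
  have e0 : (0 : R) < (n * m)%:R^-1 by rewrite invr_gt0 ltr0n muln_gt0 n0.
  have [j [_ /unit_norm_lt[k [p [p0 _ hk kp]]]]] := hl _ 0%N e0.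
  exists p; split=> //.
  have knm : (k * (n * m) <= p)%N.
    move: kp; rewrite ltr_pdivrMr ?ltr0n// mulrC ltr_pdivlMr ?ltr0n ?muln_gt0 ?n0//.
    by rewrite -natrM ltr_nat => /ltnW.
  apply: le_trans (gMn_leMn htr _ _ _ u0 knm).
  apply: le_trans (_ : (Y j - l) *+ p *+ (n * m) <= _); last first.
    by rewrite [leRHS]mulrnA; exact: gleMn.
  have -> : (Y j - l) *+ p *+ (n * m) = (Y j - l) *+ n *+ (m * p).
    by rewrite -!mulrnA mulnC mulnA.
  apply: gleMn => //; rewrite mulrnBl (gleD2r htr).
  by have [hX _] := PY j; exact: hX.
apply/lee_addgt0Pr => e e0.
have e20 : 0 < e / 2 by lra.
pose N := Num.bound (2 / e).
have [j [Nj /unit_norm_lt[k [p [p0 hk _ kp]]]]] := hl _ N e20.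
have [_ /(_ s)] := PY j.
have hj : (2 ^+ j)^-1 < e / 2.
  have : 2 / e < 2 ^+ j by exact: upper_nthrootP.
  rewrite ltr_pdivrMr// => h; rewrite -[ltLHS]mul1r ltr_pdivrMr ?exprn_gt0//; lra.
have hl' : natural_map l s <= natural_map (Y j) s + k%:R / p%:R.
  have := state_le _ _ s hk; rewrite stateN !stateMn stateB state_unit mulr1.
  by rewrite -lerBlDl ler_pdivlMr ?ltr0n//; lra.
case: (q s) => [r| |//]; last by rewrite addye// => _; exact: leey.
by rewrite -EFinD !lee_fin; lra.
Qed.

End completion.

(** * Approximation of q from below *)

Lemma convex_comb_exists (t : R) s1 s2 : 0 <= t <= 1 ->
  exists s, is_convex_comb t s s1 s2.
Proof.
move=> /andP[t0 t1].
have fst : state_space R u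
    (fun x => t * natural_map x s1 + (1 - t) * natural_map x s2).
  split=> [x y|x y xy|]; first by rewrite !stateD; lra.
    by rewrite lerD// ler_wpM2l ?subr_ge0//; exact: state_le.
  by rewrite !state_unit; lra.
by exists (exist (fun g => g \in state_space R u) _ (mem_set fst)).
Qed.

Lemma state_sum (I : finType) (x : I -> G) s :
  natural_map (\sum_i x i) s = \sum_i natural_map (x i) s.
Proof.
by apply: (big_morph (fun y => natural_map y s)) => [y z|]; [exact: stateD|exact: state0].
Qed.

(** Round the coefficients n * l i and n * b down to integers: the error is at
    most M / n, where M bounds, uniformly in s, one plus the sum of the absolute
    values of the s (x i). *)
Lemma rational_approximation (I : finType) (l : I -> R) (x : I -> G) (b e : R) :
  0 < e -> exists (n : nat) (y : G), (0 < n)%N /\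
    forall s, `|\sum_i l i * natural_map (x i) s + b - natural_map y s / n%:R| <= e.
Proof.
move=> e0; have [N hN] := choice (fun i => state_bounded (x i)).
pose M : R := \sum_i (N i)%:R + 1.
pose n := (Num.bound `|M / e|).+1.
have n0 : (0 : R) < n%:R by rewrite ltr0n.
have Mn : M <= e * n%:R.
  rewrite mulrC -ler_pdivrMr//; apply: (le_trans (ler_norm _)); apply: ltW.
  by apply: (lt_trans (archi_boundP (normr_ge0 _))); rewrite ltr_nat.
exists n, (\sum_i x i *~ Num.floor (n%:R * l i) + u *~ Num.floor (n%:R * b)).
split=> // s; rewrite stateD state_sum stateMz state_unit mulr1.
have floorB (a : R) : `|a - (Num.floor a)%:~R| <= 1.
  have /andP[h1 h2] := floor_itv a; move: h2; rewrite intrD.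
  by rewrite ger0_norm ?subr_ge0//; lra.
rewrite -(ler_pM2r n0) -[X in _ * X](ger0_norm (ltW n0)) -normrM mulrBl divfK ?gt_eqF//.
apply: le_trans Mn; rewrite mulrDl mulr_suml opprD addrACA -sumrB [b * _]mulrC.
apply: (le_trans (ler_normD _ _)); apply: lerD; last exact: floorB.
apply: (le_trans (ler_norm_sum _ _ _)); apply: ler_sum => i _.
rewrite stateMz mulrAC -mulrBl normrM [l i * _]mulrC -[leRHS]mul1r.
by rewrite ler_pM// floorB.
Qed.

(** For s0 and r' < q s0, the affine functions g x s = r' + s x - s0 x take the
    value r' at s0. No state s satisfies q s <= g x s for all x: multiples of x
    would force s x = s0 x, hence s = s0. By compactness finitely many x suffice
    to exclude every state, and a convex combination of their g x lies below q.
    It is then perturbed to have rational coefficients. *)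
Lemma affine_minorant (q : S -> \bar R) s0 (r : R) :
  affine_on_states q -> lower_semicontinuous q -> (forall s, q s <> -oo%E) ->
  (r%:E < q s0)%E ->
  exists (n : nat) (y : G), [/\ (0 < n)%N, r < natural_map y s0 / n%:R &
    forall s, ((natural_map y s / n%:R)%:E <= q s)%E].
Proof.
move=> qaff qlsc qNoo rq.
have [r' rr' r'q] : exists2 r', r < r' & (r'%:E < q s0)%E.
  case: (q s0) rq => [a| |//]; rewrite ?lte_fin => ra.
    by exists ((r + a) / 2); rewrite ?lte_fin; lra.
  by exists (r + 1); [lra|exact: ltry].
pose g x s := r' + (natural_map x s - natural_map x s0).
have [xs hxs] : exists xs : seq G, forall s, exists2 x, x \in xs & ((g x s)%:E < q s)%E.
  apply: contrapT => hno.
  pose K (xs : seq G) := \bigcap_(x in [set` xs]) [set s | (q s <= (g x s)%:E)%E].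
  have [||_ [xs _ <-]|_ _ [xs _ <-] [ys _ <-]|s hs] :=
    compact_directed_bigcap S [set K xs | xs in [set: seq G]].
  - exact: compact_states.
  - by exists (K [::]), [::].
  - split.
      apply: closed_bigI => x _; apply: (closed_lsc_le q qlsc (g x)) => s.
      exact: (cvgD (cvg_cst r') (cvgB (natural_map_continuous x s) (cvg_cst _))).
    apply: contrapT => hK; apply: hno; exists xs => s; apply: contrapT => hx.
    apply: hK; exists s => x /= xxs; rewrite leNgt; apply/negP => gq.
    by apply: hx; exists x.
  - exists (K (xs ++ ys)); first by exists (xs ++ ys).
    move=> s hs; split=> x /= hx; apply: hs => /=; rewrite mem_cat hx ?orbT//.
  have qg x : (q s <= (g x s)%:E)%E.
    have hx : K [:: x] s by apply: hs; exists [:: x].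
    by apply: hx; exact: mem_head.
  case E : (q s) => [a| |]; last by have := qNoo s E.
    have d0 x : natural_map x s - natural_map x s0 = 0.
      apply: (@eq0_of_bounded_multiples _ _ (r' - a)) => n.
      have := qg (x *+ n); have := qg (- (x *+ n)).
      rewrite /g E !lee_fin !stateN !stateMn.
      by case: (ler0P (natural_map x s - _)) => _; lra.
    have ss0 : s = s0.
      by apply/val_inj/funext => x; apply/eqP; rewrite -subr_eq0; apply/eqP; exact: d0.
    have := qg 0; rewrite /g !state0 subrr addr0 ss0 => /le_lt_trans/(_ r'q).
    by rewrite ltxx.
  by have := qg 0; rewrite E leye_eq.
have [[s1 [a1 qs1]]|nfin] := pselect (exists s a, q s = a%:E); last first.
  have qoo s : q s = +oo%E.
    case E : (q s) => [a|//|]; last by have := qNoo s E.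
    by exfalso; apply: nfin; exists s, a.
  exists 1%N, (u *+ Num.bound `|r|); split=> // [|s]; last by rewrite qoo leey.
  rewrite divr1 stateMn state_unit mulr1.
  exact: le_lt_trans (ler_norm _) (archi_boundP (normr_ge0 _)).
pose x (i : 'I_(size xs)) := nth 0 xs i.
pose C := [set v : {ffun 'I_(size xs) -> R} |
  exists s a, q s = a%:E /\ v = [ffun i => a - g (x i) s]].
have [|||l [l0 l1 lC]] := convex_alternative C.
- by exists [ffun i => a1 - g (x i) s1], s1, a1.
- move=> t _ _ t01 [s [a [qs ->]]] [s' [a' [qs' ->]]].
  have [s'' hs''] := convex_comb_exists t s s' t01.
  exists s'', (t * a + (1 - t) * a'); split.
    by rewrite (qaff _ _ _ _ t01 hs'') qs qs'.
  apply/ffunP => i; rewrite !ffunE /g.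
  have -> : natural_map (x i) s'' =
    t * natural_map (x i) s + (1 - t) * natural_map (x i) s' by exact: hs''.
  lra.
- move=> _ [s [a [qs ->]]]; have [y /(nthP 0)[i ixs iy]] := hxs s.
  rewrite qs lte_fin => ya; exists (Ordinal ixs).
  by rewrite ffunE /x /= iy subr_ge0 ltW.
pose b := r' - \sum_i l i * natural_map (x i) s0.
pose A s := \sum_i l i * natural_map (x i) s + b.
have Aq s : ((A s)%:E <= q s)%E.
  case E : (q s) => [a| |]; last by have := qNoo s E.
    have := lC _ (ex_intro _ s (ex_intro _ a (conj E erefl))).
    rewrite lee_fin (_ : \sum_i _ = a - A s) ?subr_ge0//.
    have -> : a - A s = (\sum_i l i) * (a - r') -
        \sum_i l i * natural_map (x i) s + \sum_i l i * natural_map (x i) s0.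
      by rewrite l1 /A /b; lra.
    rewrite mulr_suml -sumrB -big_split /=; apply: eq_bigr => i _.
    by rewrite ffunE /g; lra.
  exact: leey.
(* the approximation of A - (r' - r) / 2 within (r' - r) / 4 stays below A and
   keeps a value above r at s0 *)
have e0 : 0 < (r' - r) / 4 by lra.
have [n [y [n0 hy]]] := rational_approximation _ l x (b - (r' - r) / 2) _ e0.
exists n, y; split=> // [|s].
  have := hy s0; rewrite /b ler_norml; lra.
apply: le_trans (Aq s); rewrite lee_fin /A; have := hy s; rewrite ler_norml; lra.
Qed.

(** * Suprema of intervals *)

Section interval_supremum.
Variables (a : set G) (q : S -> \bar R).
Hypotheses (ha : Defs.is_interval a) (qNoo : forall s, q s <> -oo%E).
Hypothesis qsup : forall s, q s = ereal_sup [set (natural_map x s)%:E | x in a].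

Lemma interval_le_sup x s : a x -> ((natural_map x s)%:E <= q s)%E.
Proof. by move=> ax; rewrite qsup; apply: ereal_sup_ubound; exists x. Qed.

Lemma interval_sup_le s (c : \bar R) :
  (forall x, a x -> ((natural_map x s)%:E <= c)%E) -> (q s <= c)%E.
Proof. by move=> h; rewrite qsup; apply: ge_ereal_sup => _ [x ax <-]; exact: h. Qed.

Lemma interval_sup_gt s (c : R) : (c%:E < q s)%E ->
  exists2 x, a x & c < natural_map x s.
Proof. by rewrite qsup => /ereal_sup_gt[_ [x ax <-]]; rewrite lte_fin; exists x. Qed.

(** For 0 < t < 1, directedness lets the elements that approximate q s1 and q s2
    be replaced by a common upper bound. At t = 0 and t = 1 one of the values
    may be infinite and is killed by the zero coefficient. *)
Lemma interval_sup_affine : affine_on_states q.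
Proof.
have [[x0 ax0] adir _] := ha.
move=> t s s1 s2 /andP[t0 t1] hs.
have sE x : natural_map x s = t * natural_map x s1 + (1 - t) * natural_map x s2.
  exact: hs.
have t1' : 0 <= 1 - t by rewrite subr_ge0.
apply/eqP; rewrite eq_le; apply/andP; split.
  apply: interval_sup_le => x ax; rewrite sE EFinD !EFinM.
  by apply: leeD; apply: lee_wpmul2l; rewrite ?lee_fin//; exact: interval_le_sup.
have [t00|tn0] := eqVneq t 0.
  rewrite t00 mul0e add0e subr0 mul1e; apply: interval_sup_le => x ax.
  by have := interval_le_sup x s ax; rewrite sE t00 mul0r add0r subr0 mul1r.
have [t11|tn1] := eqVneq t 1.
  rewrite t11 subrr mul0e adde0 mul1e; apply: interval_sup_le => x ax.
  by have := interval_le_sup x s ax; rewrite sE t11 subrr mul0r addr0 mul1r.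
have tp : 0 < t by rewrite lt_neqAle eq_sym tn0.
have tp' : 0 < 1 - t by rewrite subr_gt0 lt_neqAle tn1.
case E : (q s) => [r| |]; [|by rewrite leey|by have := qNoo s E].
have key x y : a x -> a y -> t * natural_map x s1 + (1 - t) * natural_map y s2 <= r.
  move=> ax ay; have [z az [xz yz]] := adir _ _ ax ay.
  have := interval_le_sup z s az; rewrite E lee_fin sE; apply: le_trans.
  by apply: lerD; rewrite ler_pM2l//; exact: state_le.
have q1le y : a y -> (q s1 <= ((r - (1 - t) * natural_map y s2) / t)%:E)%E.
  move=> ay; apply: interval_sup_le => x ax; rewrite lee_fin ler_pdivlMr//.
  by have := key _ _ ax ay; lra.
have [r1 q1] : exists r1, q s1 = r1%:E.
  have := q1le _ ax0; have := qNoo s1.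
  by case: (q s1) => [r1| |]//; exists r1.
have q2le : (q s2 <= ((r - t * r1) / (1 - t))%:E)%E.
  apply: interval_sup_le => y ay; rewrite lee_fin ler_pdivlMr//.
  by have := q1le _ ay; rewrite q1 lee_fin ler_pdivlMr//; lra.
have := qNoo s2; case E2 : (q s2) q2le => [r2| |]// + _.
by rewrite q1 -!EFinM -EFinD !lee_fin ler_pdivlMr//; lra.
Qed.

Lemma interval_sup_lsc : lower_semicontinuous q.
Proof.
move=> s c /interval_sup_gt[x ax cx].
exists [set s' | c < natural_map x s']; first exact: (cvgr_gt _ (natural_map_continuous x s)).
by move=> s' /= cs'; apply: lt_le_trans (interval_le_sup x s' ax); rewrite lte_fin.
Qed.

(** Values of s that are closer than the gap e around 0 are equal. So the values
    at the members of the interval become constant beyond any member whose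
    value is within e of a finite supremum. *)
Lemma interval_sup_discrete s : discrete_state s ->
  ([set r%:E | r in state_image s] `|` [set +oo%E]) (q s).
Proof.
move=> ds; case E : (q s) => [r| |]; [left|by right|by have := qNoo s E].
have [_ adir _] := ha.
have [|_ [V V0 VE]] := ds 0; first by exists 0 => //; exact: state0.
have [e /= e0 eV] := (nbhs_ballP _ _).1 V0.
have gap z : `|natural_map z s| < e -> natural_map z s = 0.
  move=> ze; have : (V `&` state_image s) (natural_map z s).
    by split; [apply: eV; rewrite /ball /= sub0r normrN|exists z].
  by rewrite VE.
have [x ax rx] : exists2 x, a x & r - e < natural_map x s.
  by apply: interval_sup_gt; rewrite E lte_fin; lra.
exists (natural_map x s); first by exists x.
congr (_%:E); apply/eqP; rewrite eq_le; apply/andP; split.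
  by have := interval_le_sup x s ax; rewrite E.
rewrite -lee_fin -E; apply: interval_sup_le => y ay; rewrite lee_fin.
have [z az [xz yz]] := adir _ _ ax ay.
apply: (le_trans (state_le _ _ s yz)).
have := interval_le_sup z s az; rewrite E lee_fin => zr.
have := state_le _ _ s xz => xzs.
have : natural_map (z - x) s = 0 by apply: gap; rewrite stateB ger0_norm; lra.
by rewrite stateB; lra.
Qed.

End interval_supremum.

End state_space.

Theorem theorem2p13 (R : realType) (G : porderZmodType) (u : G)
    (hdim : dimension_group G) (hunit : order_unit u)
    (harch : archimedean_group G) (hcomplete : norm_complete R u)
    (q : state_space R u -> \bar R) (hq : forall s, q s <> -oo%E) :
  Sigma q <->
  [/\ affine_on_states q,
      lower_semicontinuous q &
      forall s : state_space R u, extreme_state s -> discrete_state s ->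
        ([set r%:E | r in state_image s] `|` [set +oo%E]) (q s)].
Proof.
have [htr _ hunp hint] := hdim.
split=> [[a ha qa]|[qaff qlsc qdisc]].
  split=> [||s _]; first exact: (interval_sup_affine _ _ _ a).
    exact: (interval_sup_lsc _ _ _ a).
  exact: (interval_sup_discrete _ _ _ a).
have dominant := exists_dominant R G u htr hunit hunp hint harch hcomplete
  q qaff qlsc hq qdisc.
pose a := [set x : G | forall s, ((natural_map x s)%:E <= q s)%E].
have a0 : a !=set0.
  have [B hB] := lsc_bounded_below R G u hunit q qlsc hq.
  exists (- (u *+ Num.bound `|B|)) => s; apply: le_trans (hB s).
  rewrite lee_fin stateN stateMn state_unit mulr1.
  have := archi_boundP (normr_ge0 B); have := ler_norm (- B); rewrite normrN; lra.
exists a.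
  split=> [//|x y ax ay|x y xy ay s]; last first.
    by apply: le_trans (ay s); rewrite lee_fin; exact: state_le.
  have [||z hz az] := dominant 1%N x [:: y] => //.
    by move=> z; rewrite !inE => /orP[/eqP ->|/eqP ->] s; rewrite divr1.
  exists z => //; split; rewrite -[leRHS]mulr1n; apply: hz; rewrite !inE eqxx ?orbT//.
move=> s; apply/eqP; rewrite eq_le; apply/andP; split; last first.
  by apply: ge_ereal_sup => _ [x ax <-]; exact: ax.
rewrite leNgt; apply/negP => supq.
have ub x : a x -> ((natural_map x s)%:E <= ereal_sup [set (natural_map x s)%:E | x in a])%E.
  by move=> ax; apply: ereal_sup_ubound; exists x.
have [x0 ax0] := a0; have := ub _ ax0.
case: (ereal_sup _) ub supq => [r| |] ub supq //.
  have [n [y [n0 ry yq]]] := affine_minorant R G u hunit q s r qaff qlsc hq supq.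
  have [|z hz az] := dominant n y [::] n0.
    by move=> x; rewrite inE => /eqP ->.
  have := ub _ az; rewrite lee_fin leNgt => /negP; case.
  apply: (lt_le_trans ry); rewrite ler_pdivrMr ?ltr0n// mulrC -stateMn.
  by apply: state_le; apply: hz; exact: mem_head.
by move: supq; rewrite ltNge leey.
Qed.
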